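(* Let $n,d,c\ge 1$ and $t\ge 0$ be integers. Then the ideal $I_{c,(n,d,t)}\subset S=K[x_1,\dots,x_n]$ has linear quotients with respect to the lexicographic order; that is, if $G(I_{c,(n,d,t)})=\{u_1,\dots,u_m\}$ with $u_1>_{\mathrm{lex}}u_2>_{\mathrm{lex}}\cdots>_{\mathrm{lex}}u_m$, then for every $r$ with $2\le r\le m$ the colon ideal $(u_1,\dots,u_{r-1}):u_r$ is generated by a subset of $\{x_1,\dots,x_n\}$.
   Context: $K$ is a field and the lexicographic order is induced by $x_1>x_2>\cdots>x_n$. A multiset $A=\{i_1\le i_2\le\cdots\le i_d\}$ with elements in $[n]=\{1,\dots,n\}$ is $t$-spread if $i_{k+1}-i_k\ge t$ for all $k$. For a $t$-spread multiset $A$, a block of size $r$ of $A$ is a sub-multiset of consecutive elements $B=\{i_k\le i_{k+1}\le\cdots\le i_{k+r-1}\}$ with $i_{l+1}-i_l=t$ for all consecutive elements of $B$; $|B|=r$ denotes its size (counted with multiplicity). $\mathcal A_{c,(n,d,t)}$ is the set of all $t$-spread multisets $A$ in $[n]$ with $d$ elements (counted with multiplicity) such that $|B|\le c$ for every block $B\subset A$. For a multiset $A=\{i_1\le\cdots\le i_d\}$ put $\mathbf x_A=x_{i_1}x_{i_2}\cdots x_{i_d}$. The $c$-bounded $t$-spread Veronese ideal is $I_{c,(n,d,t)}=(\mathbf x_A : A\in\mathcal A_{c,(n,d,t)})\subset S$. For a monomial ideal $I$, $G(I)$ denotes its set of minimal monomial generators. *)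

(* Defs.v *)
From HB Require Import structures.
From mathcomp Require Import all_boot all_order all_algebra.
From mathcomp Require Export mpoly.

Set Implicit Arguments.
Unset Strict Implicit.
Unset Printing Implicit Defensive.

Import Order.TTheory GRing.Theory.
Local Open Scope ring_scope.

Section Multisets.

(* A multiset in [n] is given by its enumeration i_1 <= ... <= i_d, a sequence
   over 'I_n; the element k.+1 of [n] is the ordinal of value k. *)

Definition spread (n t : nat) (A : seq 'I_n) : bool :=
  sorted (fun i j : 'I_n => (i <= j)%N && (t <= j - i)%N) A.

Definition is_block (n t : nat) (A B : seq 'I_n) : bool :=
  infix B A && sorted (fun i j : 'I_n => (j == i + t :> nat)%N) B.

Definition bounded_spread (c n d t : nat) (A : seq 'I_n) : Prop :=
  [/\ size A = d, spread t A &
      forall B : seq 'I_n, is_block t A B -> (size B <= c)%N].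

End Multisets.

Section Ideals.

Variables (K : fieldType) (n : nat).

Implicit Types I J : {mpoly K[n]} -> Prop.

Definition ideal_gen (G : {mpoly K[n]} -> Prop) : {mpoly K[n]} -> Prop :=
  fun p => exists s : seq ({mpoly K[n]} * {mpoly K[n]}),
    (forall q, q \in s -> G q.2) /\ p = \sum_(q <- s) q.1 * q.2.

Definition monomial_ideal (u : seq 'X_{1..n}) : {mpoly K[n]} -> Prop :=
  ideal_gen (fun p => exists2 m, m \in u & p = 'X_[m]).

Definition ideal_eq I J : Prop := forall p, I p <-> J p.

(* The colon ideal I : f for a single element f, i.e. I : (f). *)
Definition colon I (f : {mpoly K[n]}) : {mpoly K[n]} -> Prop :=
  fun p => I (p * f).

(* u lists G(I): its monomials generate I and no proper subset does. *)
Definition minimal_monomial_generators I (u : seq 'X_{1..n}) : Prop :=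
  ideal_eq (monomial_ideal u) I /\
  forall v : seq 'X_{1..n}, {subset v <= u} ->
    ideal_eq (monomial_ideal v) I -> {subset u <= v}.

(* Pure lexicographic comparison of exponent vectors, for x_1 > ... > x_n. The
   default order on 'X_{1..n} is not used as it compares total degrees first. *)
Definition lex_gt (m1 m2 : 'X_{1..n}) : bool :=
  ((multinom_val m2 : n.-tuplelexi nat) < (multinom_val m1 : n.-tuplelexi nat))%O.

Definition generated_by_variables I : Prop :=
  exists V : {set 'I_n},
    ideal_eq I (ideal_gen (fun p => exists2 i, i \in V & p = 'X_i)).

(* u_r is the entry of index r.-1 of u. *)
Definition lex_linear_quotients I : Prop :=
  forall u : seq 'X_{1..n},
    minimal_monomial_generators I u -> sorted lex_gt u ->
    forall r : nat, (2 <= r <= size u)%N ->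
      generated_by_variables
        (colon (monomial_ideal (take r.-1 u)) 'X_[nth 0%MM u r.-1]).

Definition bounded_spread_veronese (c d t : nat) : {mpoly K[n]} -> Prop :=
  ideal_gen (fun p => exists2 A : seq 'I_n,
    bounded_spread c d t A & p = \prod_(i <- A) 'X_i).

End Ideals.

(* Main.v *)
Require Import Defs.
From mathcomp Require Import all_boot all_order all_algebra.

(** The exchange behind the theorem moves a single element.  Let A and B be
    admissible multisets with x_B lexicographically larger than x_A.  Written
    increasingly, both start with a common part P, after which B continues with
    some v and A with some w > v ([lex_gt_exponents]).  Let A' be A with that w
    replaced by v.  Up to v, the multiset A' is an initial part of B; after v, it
    is a final part of A; and the gap following v is strictly larger than the gap
    that followed w in A, hence larger than t.  So A' is t-spread and no block of
    A' crosses this gap: every block of A' is a block of B or of A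
    ([bounded_spread_exchange]).  Thus x_A' is again a generator, it precedes x_A,
    it divides x_v * x_A, and x_v divides x_B / gcd(x_B, x_A).

    Membership in a monomial ideal is tested monomial by monomial
    ([ideal_gen_monomialsP]), so such an exchange for every earlier generator
    makes the colon ideal generated by variables ([colon_generated_by_variables]).
    As all the x_A have the same degree d, none of them divides another, and the
    minimal generators are exactly the x_A ([equigenerated_minimal_generators]). *)

Set Implicit Arguments.
Unset Strict Implicit.
Unset Printing Implicit Defensive.

Import Order.TTheory GRing.Theory.
Local Open Scope ring_scope.

(** * Monomial ideals *)

Section MonomialIdeals.

Variables (K : fieldType) (n : nat).
Implicit Types (p : {mpoly K[n]}) (m g : 'X_{1..n}) (G : {mpoly K[n]} -> Prop).

Lemma ideal_genD G p q :
  ideal_gen G p -> ideal_gen G q -> ideal_gen G (p + q).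
Proof.
move=> [s [Gs ->]] [s' [Gs' ->]]; exists (s ++ s'); rewrite big_cat; split=> // r.
by rewrite mem_cat => /orP[/Gs|/Gs'].
Qed.

Lemma ideal_genMl G p q : G q -> ideal_gen G (p * q).
Proof.
by move=> Gq; exists [:: (p, q)]; rewrite big_seq1; split=> // r; rewrite inE => /eqP->.
Qed.

(** The criterion is necessary because multiplying by 'X_[g] only produces
    multiples of g, and sums create no new monomials. *)
Lemma ideal_gen_monomialsP (P : 'X_{1..n} -> Prop) p :
  ideal_gen (fun q => exists2 m, P m & q = 'X_[m]) p <->
  {in msupp p, forall m, exists2 g, P g & (g <= m)%MM}.
Proof.
split=> [[s [Gs ->]] m /msupp_sum_le /flattenP[ms /mapP[q]]|hp].
  rewrite filter_predT => qs ->; have [g Pg ->] := Gs q qs.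
  rewrite (perm_mem (msuppMX _ _)) => /mapP[m' _ ->].
  by exists g => //; apply: lem_addr.
rewrite [p]mpolyE big_seq.
apply: (big_ind (ideal_gen _)) => [|q r|m /hp[g Pg gm]].
- by exists [::]; rewrite big_nil.
- exact: ideal_genD.
by rewrite -(submK gm) mpolyXD scalerAl; apply: ideal_genMl; exists g.
Qed.

Lemma monomial_idealP (u : seq 'X_{1..n}) p :
  monomial_ideal u p <->
  {in msupp p, forall m, exists2 g, g \in u & (g <= m)%MM}.
Proof. exact: ideal_gen_monomialsP. Qed.

Lemma mem_ideal_gen_monomial (P : 'X_{1..n} -> Prop) m :
  ideal_gen (fun q : {mpoly K[n]} => exists2 m, P m & q = 'X_[m]) 'X_[m] <->
  exists2 g, P g & (g <= m)%MM.
Proof.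
rewrite ideal_gen_monomialsP msuppX.
by split=> [|h _ /[1!inE]/eqP->//]; apply; rewrite inE.
Qed.

Lemma mem_monomial_ideal (u : seq 'X_{1..n}) m :
  monomial_ideal u ('X_[m] : {mpoly K[n]}) <->
  exists2 g, g \in u & (g <= m)%MM.
Proof. exact: mem_ideal_gen_monomial. Qed.

Lemma lem_mdeg_eq m g : (g <= m)%MM -> mdeg g = mdeg m -> g = m.
Proof.
move=> /submK def_m; rewrite -{1}def_m mdegD => /eqP.
rewrite -[X in X == _]add0n eqn_add2r eq_sym mdeg_eq0 => /eqP m0.
by rewrite -def_m m0 add0m.
Qed.

(** Within a single degree, divisibility of monomials is equality, so every
    generating family of monomials contains all those of P; the ones of degree d
    then suffice, and minimality excludes the others. *)
Lemma equigenerated_minimal_generators (P : 'X_{1..n} -> Prop) d I u :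
    (forall m, P m -> mdeg m = d) ->
    ideal_eq (ideal_gen (fun q : {mpoly K[n]} => exists2 m, P m & q = 'X_[m])) I ->
    minimal_monomial_generators I u ->
  forall m, m \in u <-> P m.
Proof.
move=> degP genI [genu minu].
have divu m : m \in u -> exists2 g, P g & (g <= m)%MM.
  move=> mu; apply/mem_ideal_gen_monomial/genI/genu.
  by apply/mem_monomial_ideal; exists m; rewrite ?lepm_refl.
have Pu m : P m -> m \in u.
  move=> Pm; have /mem_monomial_ideal[g gu gm] : monomial_ideal u ('X_[m] : {mpoly K[n]}).
    by apply/genu/genI/mem_ideal_gen_monomial; exists m; rewrite ?lepm_refl.
  have [h Ph hg] := divu g gu.
  have hm : h = m by apply: lem_mdeg_eq (lepm_trans hg gm) _; rewrite !degP.
  have -> // : m = g.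
  by apply/mnmP => i; apply/eqP; rewrite eqn_leq -{1}hm (mnm_lepP hg) (mnm_lepP gm).
move=> m; split=> [mu|/Pu //].
have degu : {subset u <= [seq m <- u | mdeg m == d]}.
  apply: minu => [g|p]; first by rewrite mem_filter => /andP[].
  split=> [pd|/genI/ideal_gen_monomialsP pP].
    apply/genu/monomial_idealP => g.
    move/monomial_idealP: pd => /[apply] -[h].
    by rewrite mem_filter => /andP[_ hu] hg; exists h.
  apply/monomial_idealP => g /pP[h Ph hg]; exists h => //.
  by rewrite mem_filter (degP _ Ph) eqxx Pu.
have [g Pg gm] := divu m mu; suff -> : m = g by [].
apply/esym/(lem_mdeg_eq gm); rewrite (degP _ Pg).
by have /[!mem_filter]/andP[/eqP] := degu m mu.
Qed.

(** If h : g denotes h divided by gcd(h, g), the colon ideal is generated by the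
    monomials h : g with h in s; the hypothesis says that each of them is a
    multiple of a variable belonging to the colon ideal. *)
Lemma colon_generated_by_variables (s : seq 'X_{1..n}) g :
    {in s, forall h : 'X_{1..n}, exists2 i, (g i < h i)%N &
       exists2 h', h' \in s & (h' <= U_(i) + g)%MM} ->
  generated_by_variables (colon (monomial_ideal s) ('X_[g] : {mpoly K[n]})).
Proof.
move=> exch; pose V := [set i | has (fun h => h <= U_(i) + g)%MM s].
pose PV m := exists2 i, i \in V & m = U_(i)%MM.
have genV p : ideal_gen (fun q : {mpoly K[n]} => exists2 i, i \in V & q = 'X_i) p <->
    ideal_gen (fun q : {mpoly K[n]} => exists2 m, PV m & q = 'X_[m]) p.
  split=> -[r [Gr ->]]; exists r; split=> // q /Gr [m Hm ->].
    by exists U_(m)%MM => //; exists m.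
  by case: Hm => i iV ->; exists i.
exists V => p; rewrite genV ideal_gen_monomialsP /colon monomial_idealP; split=> H m.
  move=> mp; have /H[h hs hm] : (g + m)%MM \in msupp (p * 'X_[g]).
    by rewrite (perm_mem (msuppMX _ _)) map_f.
  have [i lti [h' h's h'i]] := exch h hs.
  exists U_(i)%MM; first by exists i => //; rewrite inE; apply/hasP; exists h'.
  move/mnm_lepP/(_ i): hm; rewrite mnmDE lep1mP => /(leq_trans lti).
  by case: (m i) => //; rewrite addn0 ltnn.
rewrite (perm_mem (msuppMX _ _)) => /mapP[m' /H[_ [i iV ->] im'] ->].
move: iV; rewrite inE => /hasP[h hs hi]; exists h => //; apply: lepm_trans hi _.
by rewrite addmC; apply/mnm_lepP=> j; rewrite !mnmDE leq_add2l (mnm_lepP im').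
Qed.

End MonomialIdeals.

(** * Exponent vectors and the lexicographic order *)

Section Exponents.

Variable n : nat.
Implicit Types (A B P S T : seq 'I_n) (m : 'X_{1..n}).

Lemma lex_gtP m1 m2 :
  reflect (exists2 k : 'I_n, forall i : 'I_n, (i < k)%N -> m1 i = m2 i & (m2 k < m1 k)%N)
          (lex_gt m1 m2).
Proof.
by apply: (iffP ltxi_tuplePlt) => -[k eqk ltk]; exists k => // i /eqk /esym.
Qed.

Lemma lex_gt_trans : transitive (@lex_gt n).
Proof. by move=> m2 m1 m3 lt12 lt23; apply: lt_trans lt23 lt12. Qed.

Lemma lex_gt_irr : irreflexive (@lex_gt n).
Proof. by move=> m; apply: ltxx. Qed.

Definition exponents A : 'X_{1..n} := [multinom count_mem i A | i < n].

Lemma exponents_cons i A : exponents (i :: A) = (U_(i) + exponents A)%MM.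
Proof. by apply/mnmP => j; rewrite mnmDE mnm1E !mnmE. Qed.

Lemma exponents_nil : exponents [::] = 0%MM.
Proof. by apply/mnmP => j; rewrite !mnmE. Qed.

Lemma prod_exponents (K : fieldType) A :
  \prod_(i <- A) 'X_i = 'X_[exponents A] :> {mpoly K[n]}.
Proof.
elim: A => [|i A IH]; first by rewrite big_nil exponents_nil mpolyX0.
by rewrite big_cons IH exponents_cons mpolyXD.
Qed.

Lemma mdeg_exponents A : mdeg (exponents A) = size A.
Proof.
by elim: A => [|i A IH]; rewrite ?exponents_nil ?mdeg0 // exponents_cons mdegD mdeg1 IH.
Qed.

Lemma exponents_replace P S (v w : 'I_n) :
  (exponents (P ++ v :: S) + U_(w) = U_(v) + exponents (P ++ w :: S))%MM.
Proof.
by apply/mnmP => i; rewrite !mnmDE !mnm1E !mnmE !count_cat /= !addnA addnAC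
  [RHS]addnAC [X in (X + _ + _)%N]addnC addnAC.
Qed.

Lemma lex_gt_replace P S (v w : 'I_n) : (v < w)%N ->
  lex_gt (exponents (P ++ v :: S)) (exponents (P ++ w :: S)).
Proof.
move=> ltvw; apply/lex_gtP; exists v => [i ltiv|]; rewrite !mnmE !count_cat /=.
  by rewrite -!val_eqE /= !gtn_eqF // (ltn_trans ltiv).
by rewrite ltn_add2l eqxx -val_eqE /= (gtn_eqF ltvw).
Qed.

Lemma leq_ord_trans : transitive (fun i j : 'I_n => (i <= j)%N).
Proof. by move=> j i k; apply: leq_trans. Qed.

Definition weakly_increasing A := sorted (fun i j : 'I_n => (i <= j)%N) A.

(** The first place where the multiplicities differ is the first place where the
    increasing enumerations differ, and a larger multiplicity of k delays the
    moment at which the enumeration moves beyond k. *)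
Lemma lex_gt_exponents A B :
    weakly_increasing A -> weakly_increasing B -> size A = size B ->
    lex_gt (exponents B) (exponents A) ->
  exists P v w S T, [/\ A = P ++ w :: S, B = P ++ v :: T & (v < w)%N].
Proof.
elim: A B => [|a A IH] [|b B] //; first by rewrite lex_gt_irr.
move=> sA sB [eqsz] /lex_gtP[k eqk ltk].
have [ltab|ltba|/val_inj eqab] := ltngtP a b; last first.
- have [|P [v [w [S [T [-> -> ltvw]]]]]] := IH B (path_sorted sA) (path_sorted sB) eqsz.
    apply/lex_gtP; exists k => [i /eqk|]; last first.
      by move: ltk; rewrite !mnmE /= eqab ltn_add2l.
    by rewrite !mnmE /= eqab => /addnI.
  by exists (a :: P), v, w, S, T; rewrite eqab.
- by exists [::], b, a, A, B.
(* If a < b, then a has multiplicity 0 in B, and so has every k <= a. *)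
have B0 (i : 'I_n) : (i <= a)%N -> count_mem i (b :: B) = 0%N.
  move=> leia; apply/count_memPn/negP; rewrite inE => /orP[/eqP ib|].
    by move: ltab; rewrite -ib ltnNge leia.
  move=> iB; have /allP/(_ i iB) := order_path_min leq_ord_trans sB.
  by rewrite leqNgt (leq_ltn_trans leia ltab).
have [leka|ltak] := leqP k a; first by move: ltk; rewrite !mnmE B0.
by have := eqk a ltak; rewrite !mnmE B0 //= eqxx.
Qed.

End Exponents.

(** * Exchange in bounded spread multisets *)

(** A chain for e that meets both sides would have to step from v to the head of
    S, which e forbids. *)
Lemma infix_cat_break (T : eqType) (e : rel T) (P : seq T) v S C :
    (if S is s :: _ then ~~ e v s else true) ->
    sorted e C -> infix C (rcons P v ++ S) ->
  infix C (rcons P v) || infix C S.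
Proof.
set L := rcons P v => brk sC /infixP[X [Y eqL]].
have defL : take (size L) (X ++ C ++ Y) = L by rewrite -eqL take_size_cat.
have defS : drop (size L) (X ++ C ++ Y) = S by rewrite -eqL drop_size_cat.
have [leXCL|ltLXC] := leqP (size (X ++ C)) (size L).
  by rewrite -{1}defL catA take_cat ltnNge leXCL /= -catA infix_infix.
have [leLX|ltXL] := leqP (size L) (size X).
  rewrite -defS drop_cat; case: ltnP => [_|leXL]; first by rewrite infix_infix orbT.
  have -> : (size L - size X = 0)%N by apply/eqP; rewrite subn_eq0.
  by rewrite drop0 prefix_infix orbT.
(* C starts inside L and ends inside S, so it contains v followed by the head
   of S. *)
move: ltLXC; rewrite size_cat -ltn_subLR ?(ltnW ltXL) //.
move: defL defS; rewrite take_cat drop_cat [(_ < size X)%N]ltnNge (ltnW ltXL) /=.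
have: (0 < size L - size X)%N by rewrite subn_gt0.
move: (size L - size X)%N => k k0; rewrite take_cat drop_cat => + + ltk.
rewrite ltk => defL defS.
move: sC; rewrite -(cat_take_drop k C).
case: (lastP (take k C)) (size_takel (ltnW ltk)) defL => [|C1 x] /= szk.
  by move: k0; rewrite -szk.
rewrite -rcons_cat => /eqP; rewrite eqseq_rcons => /andP[_ /eqP->].
case: (drop k C) (size_drop k C) defS => [|s C2] /= szd defS.
  by move: ltk; rewrite -subn_gt0 -szd.
move: brk; rewrite -defS /= => /negPf nevs.
by rewrite cat_rcons sorted_cat_cons /= nevs andbF.
Qed.

Section BoundedSpread.

Variables (n t : nat).
Implicit Types A B P S T : seq 'I_n.

Lemma spread_weakly_increasing A : spread t A -> weakly_increasing A.
Proof. by apply: sub_sorted => i j /andP[]. Qed.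

(** Lowering w to v only widens the gap that follows, so the spread condition is
    inherited, and the widened gap separates blocks. *)
Lemma bounded_spread_exchange c d P (v w : 'I_n) S T : (v < w)%N ->
    bounded_spread c d t (P ++ w :: S) -> bounded_spread c d t (P ++ v :: T) ->
  bounded_spread c d t (P ++ v :: S).
Proof.
move=> ltvw [szA spA blA] [szB spB blB].
have gapS : is_true (if S is s :: _ then v + t < s else true)%N.
  case: S spA {szA blA} => // s S.
  rewrite /spread sorted_cat_cons /= => /andP[_ /andP[/andP[lews let_] _]].
  by apply: (@leq_trans (w + t)); rewrite ?ltn_add2r // -leq_subRL.
split; first by rewrite -szA !size_cat.
  move: spA spB; rewrite /spread !sorted_cat_cons.
  move=> /andP[_ pS] /andP[-> _] /=; case: S pS gapS {szA blA} => // s S /=.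
  move=> /andP[_ ->] ltvs; rewrite andbT.
  have ltvs' : (v <= s)%N by apply: leq_trans (ltnW ltvs); rewrite leq_addr.
  by rewrite ltvs' leq_subRL // ltnW.
move=> C /andP[]; rewrite -cat_rcons => infC sC.
have brk : is_true (if S is s :: _ then s != v + t :> nat else true)%N.
  by case: (S) gapS => // s _ ltvs; rewrite gtn_eqF.
have /orP[infP|infS] := infix_cat_break brk sC infC.
  by apply: blB; rewrite /is_block sC andbT -cat_rcons infix_catr.
by apply: blA; rewrite /is_block sC andbT -cat_rcons infix_catl.
Qed.

End BoundedSpread.

(** * Linear quotients *)

Lemma veronese_minimal_generators (K : fieldType) n c d t (u : seq 'X_{1..n}) :
    minimal_monomial_generators (@bounded_spread_veronese K n c d t) u ->
  forall m, m \in u <-> exists2 A, bounded_spread c d t A & m = exponents A.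
Proof.
apply: (equigenerated_minimal_generators (d := d)) => [_ [A [szA _ _] ->]|p].
  by rewrite mdeg_exponents.
split=> -[s [Gs ->]]; exists s; split=> // q /Gs.
  by move=> [_ [A bA ->] ->]; exists A; rewrite ?prod_exponents.
by move=> [A bA ->]; exists (exponents A); [exists A | rewrite prod_exponents].
Qed.

Lemma mem_take_sorted (T : eqType) (e : rel T) (s : seq T) x0 k x :
    transitive e -> irreflexive e -> sorted e s -> (k < size s)%N ->
  (x \in take k s) = (x \in s) && e x (nth x0 s k).
Proof.
move=> e_tr e_irr srt ltk; have := srt.
rewrite -{1 3}(cat_take_drop k s) (drop_nth x0 ltk) mem_cat inE.
rewrite sorted_pairwise // pairwise_cat /= allrel_consr.
case/and4P=> /andP[/allP lt_take _] _ /allP lt_drop _.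
have [/lt_take -> //|_ /=] := boolP (x \in take k s).
case: eqP => [->|_] /=; first by rewrite e_irr.
apply/esym/negP => /andP[/lt_drop lt1 lt2].
by have := e_tr _ _ _ lt1 lt2; rewrite e_irr.
Qed.

Theorem theorem2p1 (K : fieldType) (n d c t : nat)
  (hn : (1 <= n)%N) (hd : (1 <= d)%N) (hc : (1 <= c)%N) :
  @lex_linear_quotients K n (@bounded_spread_veronese K n c d t).
Proof.
move=> u /veronese_minimal_generators genu srtu [//|k] /= /andP[_ ltk].
have memtake := mem_take_sorted 0%MM _ (@lex_gt_trans n) (@lex_gt_irr n) srtu ltk.
apply: colon_generated_by_variables => h; rewrite memtake => /andP[].
move: memtake; have /genu[A bA ->] := mem_nth 0%MM ltk.
move=> memtake /genu[B bB ->] ltBA.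
have [szA spA _] := bA; have [szB spB _] := bB.
have [||P [v [w [S [T [eqA eqB ltvw]]]]]] := lex_gt_exponents _ _ (etrans szA (esym szB)) ltBA.
- exact: spread_weakly_increasing spA.
- exact: spread_weakly_increasing spB.
exists v.
  (* S only contains elements larger than v, so v occurs in A within P only. *)
  have vS : v \notin S.
    apply/negP => vS; have := spread_weakly_increasing spA.
    rewrite /weakly_increasing eqA sorted_cat_cons => /andP[_ wS].
    have /allP/(_ v vS) := order_path_min (@leq_ord_trans n) wS.
    by rewrite leqNgt ltvw.
  rewrite eqA eqB !mnmE !count_cat /= eqxx (count_memPn vS) -val_eqE /=.
  by rewrite (gtn_eqF ltvw) ltn_add2l.
exists (exponents (P ++ v :: S)).
  rewrite memtake eqA lex_gt_replace // andbT; apply/genu; exists (P ++ v :: S) => //.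
  by rewrite eqA in bA; rewrite eqB in bB; apply: bounded_spread_exchange ltvw bA bB.
by rewrite eqA -exponents_replace lem_addr.
Qed.
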